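(* Let $\mathbb{K}$ be a field of characteristic $p>0$. For every integer $n\geq 1$, $$s_n(\mathbb{K})\geq \frac{p-1}{n},$$ and equality cannot hold if $n>1$.
   Context: $\mathbb{F}_p$ denotes the prime subfield of $\mathbb{K}$. An idempotent matrix is a matrix $Q\in \mathrm{M}_n(\mathbb{K})$ with $Q^2=Q$. For $n\geq 1$, $s_n(\mathbb{K})$ denotes the lowest integer $N$ such that every matrix $A\in \mathrm{M}_n(\mathbb{K})$ with $\operatorname{tr} A\in\mathbb{F}_p$ is a sum of $N$ idempotent matrices of $\mathrm{M}_n(\mathbb{K})$. *)

(* Defs.v *)
From HB Require Import structures.
From mathcomp Require Import all_boot all_order all_algebra.
From mathcomp Require Import boolp.
Set Implicit Arguments. Unset Strict Implicit. Unset Printing Implicit Defensive.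
Import Order.TTheory GRing.Theory Num.Theory.
Local Open Scope ring_scope.

(* The smallest subfield of K, that is, the intersection of all subfields. *)
Definition prime_subfield (K : fieldType) (x : K) : Prop :=
  forall S : {pred K}, divring_closed S -> x \in S.

Definition idempotent_mx (K : fieldType) (n : nat) (Q : 'M[K]_n) : Prop :=
  Q *m Q = Q.

(* Exactly N summands; repeated and zero summands are allowed. *)
Definition sum_of_idempotents (K : fieldType) (n N : nat) (A : 'M[K]_n) : Prop :=
  exists Q : 'I_N -> 'M[K]_n,
    (forall i, idempotent_mx (Q i)) /\ A = \sum_(i < N) Q i.

Definition idempotents_suffice (K : fieldType) (n N : nat) : Prop :=
  forall A : 'M[K]_n, prime_subfield (\tr A) -> sum_of_idempotents N A.

Lemma prime_subfieldP (K : fieldType) (p : nat) (pK : p \in [pchar K]) (x : K) :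
  prime_subfield x <-> exists k : nat, x = k%:R.
Proof.
have pr := pcharf_prime pK.
split=> [px | [k ->] S [S1 SB _]]; last first.
  have S0 : 0 \in S by rewrite -(subrr 1) SB.
  elim: k => // k IHk.
  by rewrite -natr1 -[X in _ + X]opprK SB // -sub0r SB.
pose S : {pred K} := fun x => `[< exists k : nat, x = k%:R >].
have SM (a b : nat) : (a%:R : K) - b%:R = (a + b * p.-1)%:R.
  rewrite natrD natrM -subn1 natrB ?prime_gt0 // (pcharf0 pK) sub0r.
  by rewrite mulrN mulr1.
have SK : divring_closed S.
  split; first by apply/asboolP; exists 1%N.
    move=> _ _ /asboolP[a ->] /asboolP[b ->]; apply/asboolP.
    by exists (a + b * p.-1)%N.
  move=> _ _ /asboolP[a ->] /asboolP[b ->]; apply/asboolP.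
  have [->|b0] := eqVneq (b%:R : K) 0; first by exists 0%N; rewrite invr0 mulr0.
  exists (a * b ^ (p.-2))%N; rewrite natrM natrX.
  congr (_ * _); apply: (mulfI b0); rewrite divff //; apply: (mulfI b0).
  rewrite mulr1 -!exprS.
  have -> : p.-2.+2 = p by case: (p) (prime_gt1 pr) => [|[|]].
  by rewrite -(pFrobenius_autE pK) pFrobenius_aut_nat.
exact/asboolP/(px S SK).
Qed.

Section SumOfIdempotents.
Variables (K : fieldType) (n : nat).
Implicit Types A B Q : 'M[K]_n.

Lemma sum_of_idempotents0 N : sum_of_idempotents N (0 : 'M[K]_n).
Proof.
exists (fun=> 0); split=> [i|]; first by rewrite /idempotent_mx mulmx0.
by rewrite big1.
Qed.

Lemma sum_of_idempotents1 Q : idempotent_mx Q -> sum_of_idempotents 1 Q.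
Proof. by exists (fun=> Q); split=> //; rewrite big_ord1. Qed.

Lemma sum_of_idempotentsD N M A B :
  sum_of_idempotents N A -> sum_of_idempotents M B ->
  sum_of_idempotents (N + M) (A + B).
Proof.
move=> [QA [idA ->]] [QB [idB ->]].
exists (fun i => match split i with inl j => QA j | inr j => QB j end).
split=> [i|]; first by case: (split i).
rewrite big_split_ord; congr (_ + _); apply: eq_bigr => i _.
  by rewrite (unsplitK (inl _ i)).
by rewrite (unsplitK (inr _ i)).
Qed.

Lemma sum_of_idempotentsMn Q k : idempotent_mx Q -> sum_of_idempotents k (Q *+ k).
Proof.
move=> idQ; elim: k => [|k IHk]; first exact: sum_of_idempotents0.
by rewrite mulrSr -addn1; exact/sum_of_idempotentsD/sum_of_idempotents1.
Qed.

Lemma sum_of_idempotents_leq N M A :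
  (N <= M)%N -> sum_of_idempotents N A -> sum_of_idempotents M A.
Proof.
move=> /subnKC <- NA; rewrite -[A]addr0.
exact/sum_of_idempotentsD/sum_of_idempotents0.
Qed.

Lemma sum_of_idempotents_sum k N (F : 'I_k -> 'M[K]_n) :
  (forall i, sum_of_idempotents N (F i)) ->
  sum_of_idempotents (k * N) (\sum_i F i).
Proof.
elim: k F => [|k IHk] F NF; first by rewrite big_ord0; exact: sum_of_idempotents0.
by rewrite big_ord_recl mulSn; apply: sum_of_idempotentsD => //; exact: IHk.
Qed.

Variables (p : nat) (pK : p \in [pchar K]).

Lemma sum_of_idempotents_sqr0 (u : 'cV[K]_n) (v w : 'rV[K]_n) :
  v *m u = 0 -> w *m u = 1%:M -> sum_of_idempotents p (u *m v).
Proof.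
move=> vu wu; have p0 := prime_gt0 (pcharf_prime pK).
have idem (z : 'rV[K]_n) : z *m u = 1%:M -> idempotent_mx (u *m z).
  by move=> zu; rewrite /idempotent_mx mulmxA -(mulmxA u) zu mulmx1.
have -> : u *m v = u *m (w + v) + (u *m w) *+ p.-1.
  apply/(addIr (u *m w)); rewrite -addrA -mulrSr prednK //.
  by rewrite -(scaler_nat p) (pcharf0 pK) scale0r addr0 mulmxDr addrC.
rewrite -(prednK p0) -add1n; apply: sum_of_idempotentsD.
  by apply/sum_of_idempotents1/idem; rewrite mulmxDl vu addr0.
exact/sum_of_idempotentsMn/idem.
Qed.

Lemma sum_of_idempotents_delta (a : K) (i j : 'I_n) :
  i != j -> sum_of_idempotents p (a *: delta_mx i j).
Proof.
move=> ij; rewrite -(mul_delta_mx (0 : 'I_1)) scalemxAr.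
apply: (@sum_of_idempotents_sqr0 _ _ (delta_mx 0 i)).
  by rewrite -scalemxAl mul_delta_mx_0 1?eq_sym // scaler0.
by rewrite mul_delta_mx; apply/matrixP=> x y; rewrite !ord1 !mxE.
Qed.

Lemma sum_of_idempotents_diag (a : K) (i j : 'I_n) :
  sum_of_idempotents (p + (p + p)) (a *: (delta_mx i i - delta_mx j j)).
Proof.
have [->|ij] := eqVneq i j.
  by rewrite subrr scaler0; exact: sum_of_idempotents0.
have ji : j != i by rewrite eq_sym.
pose u : 'cV[K]_n := delta_mx i 0 + delta_mx j 0.
pose v : 'rV[K]_n := a *: (delta_mx 0 i - delta_mx 0 j).
have -> : a *: (delta_mx i i - delta_mx j j) =
    u *m v + (a *: delta_mx i j + (- a) *: delta_mx j i).
  rewrite /u /v -scalemxAr mulmxDl !mulmxBr !mul_delta_mx scaleNr -scalerBr.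
  rewrite -scalerDr; congr (_ *: _).
  set x := delta_mx i i; set y := delta_mx i j.
  set z := delta_mx j i; set t := delta_mx j j.
  by rewrite [RHS]addrACA subrK (addrAC z) subrr sub0r.
apply: sum_of_idempotentsD; last first.
  by apply: sum_of_idempotentsD; exact: sum_of_idempotents_delta.
apply: (@sum_of_idempotents_sqr0 _ _ (delta_mx 0 i)).
  rewrite /u /v -scalemxAl mulmxBl !mulmxDr !mul_delta_mx.
  by rewrite !mul_delta_mx_0 // addr0 add0r subrr scaler0.
rewrite mulmxDr mul_delta_mx mul_delta_mx_0 // addr0.
by apply/matrixP=> x y; rewrite !ord1 !mxE.
Qed.

End SumOfIdempotents.

Lemma exists_idempotents_suffice (K : fieldType) (p : nat)
    (pK : p \in [pchar K]) (n : nat) :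
  exists N, `[< idempotents_suffice K n N >].
Proof.
case: n => [|n].
  exists 0%N; apply/asboolP => A _; rewrite (flatmx0 A).
  exact: sum_of_idempotents0.
pose m := (p + (p + p))%N; have p0 := prime_gt0 (pcharf_prime pK).
exists (n.+1 * (n.+1 * m) + p)%N; apply/asboolP => A.
move=> /(prime_subfieldP pK)[k trA].
pose B i j : 'M[K]_n.+1 :=
  A i j *: (if i == j then delta_mx i i - delta_mx 0 0 else delta_mx i j).
have -> : A = \sum_i \sum_j B i j + (delta_mx 0 0) *+ (k %% p).
  have -> : delta_mx 0 0 *+ (k %% p) = \tr A *: delta_mx 0 0 :> 'M[K]_n.+1.
    rewrite trA -scaler_nat; congr (_ *: _).
    by rewrite [in RHS](divn_eq k p) natrD natrM (pcharf0 pK) mulr0 add0r.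
  rewrite {1}[A]matrix_sum_delta scaler_suml -big_split; apply: eq_bigr => i _.
  rewrite (bigD1 i) //= [in RHS](bigD1 i) //= /B eqxx scalerBr.
  rewrite addrAC subrK; congr (_ + _); apply: eq_bigr => j ji.
  by rewrite eq_sym (negPf ji).
apply: sum_of_idempotentsD; last first.
  apply: (@sum_of_idempotents_leq _ _ (k %% p)); first by rewrite ltnW ?ltn_mod.
  by apply: sum_of_idempotentsMn; rewrite /idempotent_mx mul_delta_mx.
do 2 ![apply: sum_of_idempotents_sum => ?]; rewrite /B.
case: eqVneq => [_|ij]; first exact: sum_of_idempotents_diag.
apply: sum_of_idempotents_leq (sum_of_idempotents_delta pK _ ij).
exact: leq_addr.
Qed.

(* The existence proof only makes the minimum well defined; the value of
   idempotents_number pK n depends on K and n alone. *)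
Definition idempotents_number (K : fieldType) (p : nat) (pK : p \in [pchar K])
    (n : nat) : nat :=
  ex_minn (exists_idempotents_suffice pK n).

Lemma idempotents_numberP (K : fieldType) (p : nat) (pK : p \in [pchar K])
    (n : nat) :
  idempotents_suffice K n (idempotents_number pK n) /\
  (forall N, idempotents_suffice K n N -> (idempotents_number pK n <= N)%N).
Proof.
rewrite /idempotents_number; case: ex_minnP => s /asboolP sK smin; split=> // N NK.
exact/smin/asboolP.
Qed.

(* Main.v *)
(* The trace of an idempotent is the image in K of its rank, so if -E_{00} (of
   trace -1) is the sum of N idempotents, then p divides 1 plus the sum of
   their ranks, whence p - 1 <= n N. Equality forces every rank to be n, i.e.,
   every summand to be the identity; but for n > 1 the matrix -E_{00} is not
   scalar. *)
Require Import Defs.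
From mathcomp Require Import all_boot all_order all_algebra.
Set Implicit Arguments. Unset Strict Implicit. Unset Printing Implicit Defensive.
Import Order.TTheory GRing.Theory Num.Theory.
Local Open Scope ring_scope.

(** In a rank factorization [Q = C *m R], [C] cancels on the left and [R] on the right, so
    [Q *m Q = Q] gives [R *m C = 1%:M], of size [\rank Q]; and [C *m R] and [R *m C] have equal
    traces. *)
Lemma idempotent_mx_trace (K : fieldType) (n : nat) (Q : 'M[K]_n) :
  idempotent_mx Q -> \tr Q = (\rank Q)%:R.
Proof.
move=> QQ; suff RC1 : row_base Q *m col_base Q = 1%:M.
  by rewrite -[in LHS](mulmx_base Q) mxtrace_mulC RC1 mxtrace1.
apply: (row_full_inj (col_base_full Q)).
apply: (row_free_inj (row_base_free Q)).
by rewrite mulmx1 mulmxA -mulmxA mulmx_base.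
Qed.

Lemma idempotent_mx_full_rank (K : fieldType) (n : nat) (Q : 'M[K]_n) :
  idempotent_mx Q -> \rank Q = n -> Q = 1%:M.
Proof.
move=> QQ rQ; have Qfree : row_free Q by rewrite /row_free rQ.
by apply: (row_free_inj Qfree); rewrite mul1mx.
Qed.

Lemma sum_of_idempotents_rank (K : fieldType) (p n N : nat) (A : 'M[K]_n) :
  p \in [pchar K] -> \tr A = -1 -> sum_of_idempotents N A ->
  (p.-1 <= N * n)%N /\ (p.-1 = (N * n)%N -> A = N%:R%:M).
Proof.
move=> pK trA [Q [idQ defA]].
have p_gt0 := prime_gt0 (pcharf_prime pK).
(* The sum of the ranks plus one is positive and maps to [\tr A + 1 = 0] in [K], so it is at least
   [p]. *)
have p_le : (p.-1 <= \sum_(i < N) \rank (Q i))%N.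
  rewrite -subn1 leq_subLR add1n dvdn_leq // (dvdn_pcharf pK).
  rewrite -natr1 natr_sum -(eq_bigr _ (fun i _ => idempotent_mx_trace (idQ i))).
  by rewrite -raddf_sum /= -defA trA addNr.
have rank_le i : (\rank (Q i) <= n ?= iff (\rank (Q i) == n))%N.
  by split; first exact: rank_leq_row.
(* The ranks sum to at most [N * n], with equality only if each of them is [n]. *)
have [sum_le sum_eq] := leqif_sum (fun i (_ : xpredT i) => rank_le i).
rewrite sum_nat_const card_ord in sum_le sum_eq.
split=> [|pE]; first exact: leq_trans sum_le.
have /forallP/= rankQ : [forall i, xpredT i ==> (\rank (Q i) == n)].
  by rewrite -sum_eq eqn_leq sum_le -pE.
rewrite defA (eq_bigr (fun=> 1%:M)) => [|i _].
  by rewrite sumr_const card_ord -scaler_nat scalemx1.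
exact/idempotent_mx_full_rank/eqP/rankQ.
Qed.

Theorem proposition6 (K : fieldType) (p : nat) (pK : p \in [pchar K])
    (n : nat) (n_ge1 : (1 <= n)%N) :
  (p%:R - 1) / n%:R <= (idempotents_number pK n)%:R :> rat /\
  ((1 < n)%N -> (idempotents_number pK n)%:R <> (p%:R - 1) / n%:R :> rat).
Proof.
case: n n_ge1 => // n _.
have [suffN _] := idempotents_numberP pK n.+1.
move: (idempotents_number pK n.+1) suffN => N suffN.
have p_gt0 := prime_gt0 (pcharf_prime pK).
pose A : 'M[K]_n.+1 := - delta_mx 0 0.
have trA : \tr A = -1.
  rewrite raddfN /= /mxtrace (bigD1 0) //= big1 => [|i /negPf i0].
    by rewrite mxE eqxx addr0.
  by rewrite mxE i0.
have /suffN/(sum_of_idempotents_rank pK trA)[p_le p_eq] :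
    prime_subfield (\tr A).
  (* In characteristic [p], [-1] is the image of [p.-1]. *)
  apply/(prime_subfieldP pK); exists p.-1.
  by rewrite trA -subn1 natrB // (pcharf0 pK) sub0r.
have -> : p%:R - 1 = p.-1%:R :> rat by rewrite -subn1 natrB.
have n_gt0 : 0 < n.+1%:R :> rat by rewrite ltr0n.
split=> [|n_gt1 NE]; first by rewrite ler_pdivrMr // -natrM ler_nat.
have /p_eq defA : p.-1 = (N * n.+1)%N.
  by apply/eqP; rewrite -(eqr_nat rat) natrM NE divfK // gt_eqF.
have ne0 : (ord_max == 0 :> 'I_n.+1) = false.
  by apply/negbTE; rewrite -val_eqE /= -lt0n.
(* The first and last diagonal entries of [A] are [-1] and [0], yet both would equal [N%:R]. *)
have := congr1 (fun M : 'M[K]_n.+1 => M 0 0) defA.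
have := congr1 (fun M : 'M[K]_n.+1 => M ord_max ord_max) defA.
rewrite !mxE !eqxx ne0 /= oppr0 => <- /eqP.
by rewrite oppr_eq0 oner_eq0.
Qed.
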